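(* If $G$ is a connected graph of order $n \ge 3$, then $\alpha_1(G) \le n-1$, with equality if and only if $G \cong B^3_n$ or $G \cong U_{1,n-1}$.
   Context: All graphs are finite, simple and undirected. For $S \subseteq V(G)$, $\langle S\rangle_G$ denotes the induced subgraph. A $1$-nearly vertex independent set of $G$ is a set $S \subseteq V(G)$ such that $\langle S\rangle_G$ has exactly one edge, and $\alpha_1(G)$ is the maximum cardinality of such a set. The broom $B^3_n$ is the tree of order $n$ obtained from a path $P_3$ on three vertices by adding $n-3$ new vertices and joining each of them to exactly one (the same) end-vertex of $P_3$. The graph $U_{1,n-1}$ is obtained from the star $K_{1,n-1}$ by adding one edge between two of its leaves (so it is unicyclic, containing a triangle). *)

(* Defs.v *)
From mathcomp Require Import all_boot.

Set Implicit Arguments.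
Unset Strict Implicit.
Unset Printing Implicit Defensive.

Record sgraph := SGraph {
  vertex :> finType;
  adj : rel vertex;
  adj_sym : symmetric adj;
  adj_irr : irreflexive adj }.

Definition edges (G : sgraph) : {set {set G}} :=
  [set [set p.1; p.2] | p : G * G & adj p.1 p.2].

Definition connected_graph (G : sgraph) : Prop :=
  forall x y : G, connect (@adj G) x y.

Definition isomorphic (G H : sgraph) : Prop :=
  exists2 f : G -> H, bijective f & forall x y, adj (f x) (f y) = adj x y.

Section Induced.
Variables (G : sgraph) (S : {set G}).

Definition induced_adj : rel {x : G | x \in S} :=
  [rel u v | adj (val u) (val v)].

Lemma induced_adj_sym : symmetric induced_adj.
Proof. by move=> u v; exact: adj_sym. Qed.

Lemma induced_adj_irr : irreflexive induced_adj.
Proof. by move=> u; exact: adj_irr. Qed.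

Definition induced : sgraph := SGraph induced_adj_sym induced_adj_irr.
End Induced.

Definition nearly_indep1 (G : sgraph) (S : {set G}) : bool :=
  #|edges (induced S)| == 1.

(* A graph with at least one edge has such a set (the two ends of an edge), so
   the default value 0 of an empty maximum only occurs for edgeless graphs. *)
Definition alpha1 (G : sgraph) : nat :=
  \max_(S : {set G} | nearly_indep1 S) #|S|.

(* The vertices [inl 0], [inl 1], [inl 2] form the path P_3, in this order; the
   added vertices [inr k] are all joined to its end-vertex [inl 0].  The order
   is n only when 3 <= n. *)
Definition broom3_adj (n : nat) : rel ('I_3 + 'I_(n - 3)) :=
  fun u v => match u, v with
  | inl i, inl j => (i.+1 == j :> nat) || (j.+1 == i :> nat)
  | inl i, inr _ | inr _, inl i => i == 0 :> nat
  | inr _, inr _ => false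
  end.

Lemma broom3_adj_sym n : symmetric (@broom3_adj n).
Proof. by case=> i [] j //=; rewrite orbC. Qed.

Lemma broom3_adj_irr n : irreflexive (@broom3_adj n).
Proof. by case=> i //=; rewrite orbb gtn_eqF. Qed.

Definition broom3 (n : nat) : sgraph :=
  SGraph (@broom3_adj_sym n) (@broom3_adj_irr n).

(* The star K_{1,m} with centre [None] and leaves [Some i], plus an edge between
   the leaves [Some 0] and [Some 1]; U_{1,m} is meant for 2 <= m only. *)
Definition U1_adj (m : nat) : rel (option 'I_m) :=
  fun u v => match u, v with
  | None, None => false
  | None, Some _ | Some _, None => true
  | Some i, Some j =>
      (i == 0 :> nat) && (j == 1 :> nat) || (i == 1 :> nat) && (j == 0 :> nat)
  end.

Lemma U1_adj_sym m : symmetric (@U1_adj m).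
Proof. by case=> [i|] [j|] //=; rewrite orbC andbC [X in _ || X]andbC. Qed.

Lemma U1_adj_irr m : irreflexive (@U1_adj m).
Proof. by case=> [[[|[|i]] ?]|]. Qed.

Definition U1 (m : nat) : sgraph := SGraph (@U1_adj_sym m) (@U1_adj_irr m).

(* Main.v *)
Require Import Defs.
From mathcomp Require Import all_boot zify.

Set Implicit Arguments.
Unset Strict Implicit.
Unset Printing Implicit Defensive.

(** A 1-nearly independent set omitting a single vertex [c] spans one edge
    [ab] and isolated vertices.  By connectedness every vertex other than
    [a, b, c] is adjacent to [c] only, and at least one of [a, b] is adjacent
    to [c]: exactly one gives the broom, both give the star plus an edge. *)

(* Quantifying over ordered pairs [x, y], it is enough to constrain [x]: by
   symmetry [y] is in [[set a; b]] too, and irreflexivity gives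
   [[set x; y] = [set a; b]]. *)
Lemma nearly_indep1P (G : sgraph) (S : {set G}) :
  reflect (exists a b, [/\ a \in S, b \in S, adj a b &
             {in S &, forall x y, adj x y -> x \in [set a; b]}])
          (nearly_indep1 S).
Proof.
apply: (iffP cards1P) => [[e eE]|[a [b [aS bS ab abS]]]].
  have: e \in edges (induced S) by rewrite eE set11.
  case/imsetP => -[u v]; rewrite inE /= => uv euv.
  exists (val u), (val v); split; [exact: valP | exact: valP | exact: uv |].
  move=> x y xS yS xy.
  have: [set (Sub x xS : induced S); Sub y yS] \in edges (induced S).
    by apply/imsetP; exists (Sub x xS, Sub y yS); rewrite ?inE.
  rewrite eE inE euv => /eqP/setP/(_ (Sub x xS)).
  by rewrite !inE eqxx /= -!val_eqE /= => /esym.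
exists [set (Sub a aS : induced S); Sub b bS].
apply/eqP; rewrite eqEsubset sub1set; apply/andP; split; last first.
  by apply/imsetP; exists (Sub a aS, Sub b bS); rewrite ?inE.
apply/subsetP => e /imsetP[[u v]]; rewrite inE /= => uv ->; rewrite inE.
have vu : adj (val v) (val u) by rewrite adj_sym.
(* Both ends of the edge lie in [[set a; b]] and are distinct, which leaves only the edge [ab]
   itself. *)
have := abS _ _ (valP u) (valP v) uv; have := abS _ _ (valP v) (valP u) vu.
have : val u != val v by apply/eqP => uvE; move: vu; rewrite uvE adj_irr.
rewrite !inE => uv' /orP[]/eqP vE /orP[]/eqP uE; move: uv'.
- by rewrite uE vE eqxx.
- by rewrite vE uE => _; rewrite eqEsubset !subUset !sub1set !inE -!val_eqE /= uE vE !eqxx !orbT.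
- by rewrite vE uE => _; rewrite eqEsubset !subUset !sub1set !inE -!val_eqE /= uE vE !eqxx !orbT.
- by rewrite uE vE eqxx.
Qed.

(** A path from [x] to [y] has a first step that leaves [A]. Connectedness is mostly used in this
    cut form. *)
Lemma connected_exit (G : sgraph) (A : {set G}) (x y : G) :
  connected_graph G -> x \in A -> y \notin A ->
  exists u v, [/\ u \in A, v \notin A & adj u v].
Proof.
move=> connG xA yA; case/connectP: (connG x y) => p.
elim: p x xA => [|z p IHp] x xA /=; first by move=> _ yx; rewrite yx xA in yA.
case/andP=> xz zp yE; have [zA|zA] := boolP (z \in A); first exact: IHp zA zp yE.
by exists x, z.
Qed.

(** If [S] were the whole vertex set, [ab] would be the only edge of [G], so no edge would leave
    [[set a; b]]; connectedness would then leave at most two vertices. *)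
Lemma nearly_indep1_card_lt (G : sgraph) (S : {set G}) :
  connected_graph G -> 2 < #|G| -> nearly_indep1 S -> #|S| < #|G|.
Proof.
move=> connG G_gt2 /nearly_indep1P[a [b [_ _ _ abS]]].
rewrite ltn_neqAle max_card andbT; apply: contraTneq G_gt2 => Sfull.
have inS x : x \in S.
  have/eqP -> : S == setT by rewrite eqEcard subsetT cardsT Sfull leqnn.
  exact: in_setT.
rewrite -leqNgt; have [y yab|abT] := pickP [pred y | y \notin [set a; b]].
  have [||u [v [uab vab uv]]] := @connected_exit G [set a; b] a y connG.
  - by rewrite !inE eqxx.
  - exact: yab.
  - by case/negP: vab; apply: (abS v u) => //; rewrite adj_sym.
rewrite -cardsT; apply: leq_trans (_ : #|[set a; b]| <= 2).
  by apply/subset_leq_card/subsetP => y _; exact: negbFE (abT y).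
by rewrite cards2; case: (a != b).
Qed.

Lemma alpha1_le_pred (G : sgraph) :
  connected_graph G -> 2 < #|G| -> alpha1 G <= #|G|.-1.
Proof.
move=> connG G_gt2; apply/bigmax_leqP => S /(nearly_indep1_card_lt connG G_gt2).
by case: #|G|.
Qed.

(** Deleting [c] leaves [ab] as the only edge. This elementary form avoids induced subgraphs and is
    easy to transport along isomorphisms. *)
Definition edge_off (G : sgraph) (c a b : G) : Prop :=
  [/\ a != c, b != c, adj a b &
      forall x y, x != c -> y != c -> adj x y -> x \in [set a; b]].

Lemma nearly_indep1_setC1P (G : sgraph) (c : G) :
  nearly_indep1 [set~ c] <-> exists a b, edge_off c a b.
Proof.
split=> [/nearly_indep1P|] [a [b [ac bc ab abS]]].
  rewrite !inE in ac bc; exists a, b; split=> // x y xc yc.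
  by apply: abS; rewrite !inE.
apply/nearly_indep1P; exists a, b; rewrite !inE; split=> // x y.
by rewrite !in_setC1; exact: abS.
Qed.

Lemma alpha1_eq_pred (G : sgraph) :
  connected_graph G -> 2 < #|G| ->
  (alpha1 G = #|G|.-1 <-> exists c a b : G, edge_off c a b).
Proof.
move=> connG G_gt2; split=> [alphaG|[c cab]]; last first.
  apply/eqP; rewrite eqn_leq alpha1_le_pred //= -(cardsC1 c).
  by apply: leq_bigmax_cond; apply/nearly_indep1_setC1P.
(* If no such set exists, the empty maximum is 0, whereas [#|G|.-1] is at least 2. Otherwise the
   maximum is attained, by a set that misses exactly one vertex. *)
have [S0 S0P|noS] := pickP (@nearly_indep1 G); last first.
  by move: alphaG; rewrite /alpha1 big_pred0 //; case: #|G| G_gt2 => [|[|m]].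
have [|S SP SE] := @eq_bigmax_cond _ (@nearly_indep1 G) (fun S => #|S|).
  by apply/card_gt0P; exists S0.
have /cards1P[c cE] : #|~: S| == 1.
  have := cardsC S; rewrite -SE -/(alpha1 G) alphaG; lia.
have SE' : S = [set~ c] by rewrite -cE setCK.
by exists c; apply/nearly_indep1_setC1P; rewrite -SE'.
Qed.

(** Sending [u] to the entry of [s] at rank [r u] is injective, hence bijective by cardinality; its
    inverse is the isomorphism. Comparing adjacencies becomes arithmetic on ranks. *)
Lemma isomorphic_nth (G H : sgraph) (x0 : G) (s : seq G) (r : H -> nat) :
  uniq s -> injective r -> (forall u, r u < size s) -> #|G| = #|H| ->
  (forall u v, adj (nth x0 s (r u)) (nth x0 s (r v)) = adj u v) ->
  isomorphic G H.
Proof.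
move=> s_uniq r_inj r_lt cardGH rE; pose f u := nth x0 s (r u).
have f_inj : injective f.
  by move=> u v /eqP; rewrite nth_uniq // => /eqP/r_inj.
have [|g fK gK] := inj_card_bij f_inj; first by rewrite cardGH.
by exists g => [|x y]; [exists f | rewrite -rE -!/(f _) !gK].
Qed.

Lemma isomorphic_edge_off (G H : sgraph) (c a b : H) :
  isomorphic G H -> edge_off c a b -> exists c' a' b' : G, edge_off c' a' b'.
Proof.
case=> f [g fK gK] fE [ac bc ab abH]; have g_inj := can_inj gK.
exists (g c), (g a), (g b); split; rewrite ?(inj_eq g_inj) //.
  by rewrite -fE !gK.
move=> x y; rewrite -!(can2_eq fK gK) -fE => xc yc /(abH _ _ xc yc).
by rewrite !inE -!(can2_eq fK gK).
Qed.

(** Ranks 0, 1, 2 are the path [inl 0], [inl 1], [inl 2], to be matched with [c], [a], [b]. *)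
Definition broom3_rank n (u : broom3 n) : nat :=
  match u with inl i => i | inr k => k.+3 end.

Lemma broom3_rank_inj n : injective (@broom3_rank n).
Proof.
case=> [i|k] [j|l] //=.
- by move/val_inj => ->.
- by move=> ij; have := ltn_ord i; rewrite ij.
- by move=> ij; have := ltn_ord j; rewrite -ij.
- by case=> /val_inj ->.
Qed.

(** The centre has rank 0 and the two joined leaves ranks 1 and 2, again matching [c], [a], [b]. *)
Definition U1_rank m (u : U1 m) : nat := if u is Some i then i.+1 else 0.

Lemma U1_rank_inj m : injective (@U1_rank m).
Proof. by case=> [i|] [j|] //= [] /val_inj ->. Qed.

Section Classification.
Variables (G : sgraph) (c a b : G).
Hypotheses (connG : connected_graph G) (cabP : edge_off c a b).

(** Some edge leaves [[set x]]; were its other end not [c], the edge would avoid [c] and force [x]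
    into [[set a; b]]. *)
Lemma edge_off_adj_center x : x \notin [set a; b] -> x != c -> adj c x.
Proof.
case: cabP => ac bc ab abG xab xc.
have [||u [y [/set1P -> yx xy]]] := @connected_exit G [set x] x c connG.
- exact: set11.
- by rewrite inE eq_sym.
rewrite adj_sym; have [<- //|yc] := eqVneq y c.
by rewrite (abG x y) in xab.
Qed.

(** Some edge leaves [[set a; b]], and its outer end can only be [c]. *)
Lemma edge_off_adj_end : adj c a \/ adj c b.
Proof.
case: cabP => ac bc ab abG.
have [||u [y [uab yab uy]]] := @connected_exit G [set a; b] a c connG.
- by rewrite !inE eqxx.
- by rewrite !inE negb_or eq_sym ac eq_sym.
have yc : y = c.
  apply/eqP; apply: contraNT yab => yc; apply: (abG y u) => //.
    by case/set2P: uab => ->.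
  by rewrite adj_sym.
by move: uab uy; rewrite yc adj_sym => /set2P[] ->; [left | right].
Qed.

Let s := [:: c, a, b & enum (~: [set c; a; b])].

Lemma edge_off_neq : a != b.
Proof. by case: cabP => _ _ ab _; apply: contraTneq ab => ->; rewrite adj_irr. Qed.

Lemma uniq_listing : uniq s.
Proof.
case: cabP => ac bc _ _; rewrite /= enum_uniq !inE !mem_enum !inE !eqxx !orbT /=.
by rewrite (negbTE edge_off_neq) !orbF ![c == _]eq_sym negb_or ac bc.
Qed.

Lemma size_listing : size s = #|G|.
Proof.
rewrite -(card_uniqP uniq_listing); apply: eq_card => x.
by rewrite !inE mem_enum !inE; case: eqP; case: eqP; case: eqP.
Qed.

Hypothesis ca : adj c a.

(** Vertices of index above 2 are adjacent to [c] alone, and [ca], [ab] are edges, so the only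
    freedom left is whether [cb] is an edge. *)
Lemma adj_listing i j : i < #|G| -> j < #|G| ->
  adj (nth c s i) (nth c s j) =
    [|| (i == 0) && ((j == 1) || (2 < j)), (j == 0) && ((i == 1) || (2 < i)),
        (i == 1) && (j == 2), (i == 2) && (j == 1)
      | adj c b && ((i == 0) && (j == 2) || (i == 2) && (j == 0))].
Proof.
case: cabP => ac bc ab abG.
have out k : 2 < k -> k < #|G| ->
    (nth c s k \notin [set a; b]) /\ nth c s k != c.
  rewrite -size_listing; case: k => [|[|[|k]]] //= _ k_lt.
  have := mem_nth c (k_lt : k < size (enum (~: [set c; a; b]))).
  by rewrite mem_enum !inE; case: eqP; case: eqP; case: eqP.
have star k : 2 < k -> k < #|G| -> adj c (nth c s k).
  by move=> k2 kG; have [] := out k k2 kG; exact: edge_off_adj_center.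
have indep k x : 2 < k -> k < #|G| -> x != c -> adj (nth c s k) x = false.
  move=> k2 kG xc; have [kab kc] := out k k2 kG.
  by apply: contraNF kab; exact: abG.
move=> iG jG; case: (ltnP 2 i) => i2; case: (ltnP 2 j) => j2.
- by rewrite indep //; [case: (adj c b); lia | have [] := out j j2 jG].
- case: j j2 jG => [|[|[|j]]] //= _ jG.
  + by rewrite adj_sym star //; case: (adj c b); lia.
  + by rewrite indep //; case: (adj c b); lia.
  + by rewrite indep //; case: (adj c b); lia.
- case: i i2 iG => [|[|[|i]]] //= _ iG.
  + by rewrite star //; case: (adj c b); lia.
  + by rewrite adj_sym indep //; case: (adj c b); lia.
  + by rewrite adj_sym indep //; case: (adj c b); lia.
have ac' : adj a c by rewrite adj_sym.
have ba : adj b a by rewrite adj_sym.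
by case: i i2 {iG} => [|[|[|i]]] //= _; case: j j2 {jG} => [|[|[|j]]] //= _;
   rewrite ?adj_irr ?ab ?ba ?ca ?ac' ?andbF ?andbT // adj_sym.
Qed.

Lemma edge_off_broom3_or_U1 n : #|G| = n ->
  isomorphic G (broom3 n) \/ isomorphic G (U1 (n - 1)).
Proof.
move=> Gn; have size_s : size s = n by rewrite size_listing.
have n_gt2 : 2 < n by rewrite -size_s.
have [cb|cb] := boolP (adj c b); [right | left].
- have r_lt (u : U1 (n - 1)) : U1_rank u < n.
    by case: u => [i|] /=; [have := ltn_ord i|]; lia.
  apply: (isomorphic_nth (x0 := c) uniq_listing (@U1_rank_inj _)) => [u||u v].
  + by rewrite size_s.
  + by rewrite Gn card_option card_ord; lia.
  rewrite adj_listing ?Gn // cb; case: u => [i|]; case: v => [j|] //=;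
    rewrite /U1_adj /=; lia.
- have r_lt (u : broom3 n) : broom3_rank u < n.
    by case: u => i /=; have := ltn_ord i; lia.
  apply: (isomorphic_nth (x0 := c) uniq_listing (@broom3_rank_inj _)) => [u||u v].
  + by rewrite size_s.
  + by rewrite Gn card_sum !card_ord; lia.
  rewrite adj_listing ?Gn // (negbTE cb); case: u => i; case: v => j //=;
    have := ltn_ord i; have := ltn_ord j; lia.
Qed.

End Classification.

(** This symmetry reduces the classification to the case where [c] is adjacent to [a]. *)
Lemma edge_offC (G : sgraph) (c a b : G) : edge_off c a b -> edge_off c b a.
Proof.
by case=> ac bc ab abG; split; rewrite 1?adj_sym // => x y; rewrite setUC; exact: abG.
Qed.

Lemma broom3_edge_off n :
  edge_off (inl (inord 0) : broom3 n) (inl (inord 1)) (inl (inord 2)).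
Proof.
split; rewrite -?(inj_eq (@broom3_rank_inj n)) /= ?inordK //.
move=> x y; rewrite !inE -!(inj_eq (@broom3_rank_inj n)) /= !inordK //.
by case: x => i; case: y => j /=; have := ltn_ord i; have := ltn_ord j; lia.
Qed.

(** The index [m.+2] guarantees that the leaves 0 and 1 both exist, so that [inord] returns them. *)
Lemma U1_edge_off m :
  edge_off (None : U1 m.+2) (Some (inord 0)) (Some (inord 1)).
Proof.
split=> //=; rewrite ?inordK // => -[i|] // [j|] // _ _.
by rewrite !inE -!(inj_eq (@U1_rank_inj m.+2)) /= !inordK //; lia.
Qed.

Theorem theorem5 (G : sgraph) (n : nat) (hn : 3 <= n) (hG : #|G| = n)
    (hconn : connected_graph G) :
  alpha1 G <= n - 1 /\
  (alpha1 G = n - 1 <-> isomorphic G (broom3 n) \/ isomorphic G (U1 (n - 1))).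
Proof.
subst n; split; first by rewrite subn1; exact: alpha1_le_pred.
have -> : alpha1 G = #|G| - 1 <-> exists c a b : G, edge_off c a b.
  by rewrite subn1; exact: alpha1_eq_pred.
split=> [[c [a [b cabP]]]|[isoG|]].
- have [ca|cb] := edge_off_adj_end hconn cabP.
    exact: edge_off_broom3_or_U1 hconn cabP ca _ erefl.
  exact: edge_off_broom3_or_U1 hconn (edge_offC cabP) cb _ erefl.
- exact: isomorphic_edge_off isoG (broom3_edge_off _).
(* Order at least 3 puts the star index [n - 1] in the form [m.+2]. *)
case: #|G| hn => [|[|[|m]]] //= _; rewrite subn1 => isoG.
exact: isomorphic_edge_off isoG (U1_edge_off m).
Qed.
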